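(* Consider a closed-loop multi-agent system $\mathcal{S}$ with $N$ agents operating under bounded stochastic disturbances. Let $P\ge2$ be an integer, $\theta\in(0,1)$ a violation threshold and $\delta\in(0,1)$. Let $Z_1,\dots,Z_P\in[0,1]$ be the margin-aware safety scores computed over $P$ independent Monte Carlo rollouts, let $X_p=\mathbb{1}[Z_p<\theta]$, where $X_1,\dots,X_P$ are i.i.d. Bernoulli random variables with success probability $\mathbb{P}[Z<\theta]$, and let $$\hat p_v=\frac1P\sum_{p=1}^P X_p,\qquad \hat\sigma^2=\frac{1}{P(P-1)}\sum_{1\le i<j\le P}(X_i-X_j)^2 .$$ Then, with probability at least $1-\delta$, $$\mathbb{P}[Z<\theta]\ \le\ \hat p_v+\sqrt{\frac{2\hat\sigma^2\log(2/\delta)}{P}}+\frac{7\log(2/\delta)}{3(P-1)} .$$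
   Context: System: $N$ agents with states $x_i\in\mathbb{R}^n$, controls $u_i\in\mathbb{R}^m$ and dynamics $\dot x_i=f_i(x_i)+g_i(x_i)u_i+w_i(t)$, with $f_i,g_i$ locally Lipschitz and $\|w_i(t)\|_2\le\bar w$. The $\psi$-weighted pairwise safety function is $\tilde h_{ij}(x,u)=h_{ij}(x)+\psi\,\mathcal{A}_{ij}(x)^\top(u_i-u_j)$ with $h_{ij}:\mathbb{R}^{Nn}\to\mathbb{R}$ continuously differentiable, $\psi\ge0$, $m=n$ and $\mathcal{A}_{ij}(x)=\frac{x_i-x_j}{\sqrt{\|x_i-x_j\|_2^2+\varepsilon^2}}\exp(-\|x_i-x_j\|_2^2)$, $\varepsilon>0$. Margin-aware safety scores: rollout $p$ is a closed-loop simulation $(x^{(p)},u^{(p)})$ on $[0,T]$ with its own realization of the bounded noise, starting from a state where $\tilde h_{ij}\ge0$ for all pairs $i\ne j$. Let $\mathcal{V}^{(p)}$ be the event that $\tilde h_{ij}(x^{(p)}(t),u^{(p)}(t))<0$ for some $t\in[0,T]$ and some $i\ne j$. Then $Z_p=0$ if $\mathcal{V}^{(p)}$ occurs, and otherwise $$Z_p=\min_{t\in[0,T],\,i\ne j}\frac{\tilde h_{ij}(x^{(p)}(t),u^{(p)}(t))}{\max(\tilde h_{ij}^{\max},\epsilon)},$$ where $\tilde h_{ij}^{\max}$ is the maximum value of $\tilde h_{ij}$ observed across all $P$ rollouts and $\epsilon>0$ is a small constant. $Z$ denotes a generic score with the common distribution of the $Z_p$. Standing modelling assumption: $X_1,\dots,X_P$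 are i.i.d. Bernoulli with parameter $\mathbb{P}[Z<\theta]$. The phrase ''with probability at least $1-\delta$'' refers to the random draw of the $P$ rollouts. *)

(* Defs.v *)
From HB Require Import structures.
From mathcomp Require Import all_boot all_order all_algebra.
From mathcomp Require Import all_classical all_reals all_analysis.
Set Implicit Arguments.
Unset Strict Implicit.
Unset Printing Implicit Defensive.
Import Order.TTheory GRing.Theory Num.Theory.
Import numFieldNormedType.Exports.
Local Open Scope classical_set_scope.
Local Open Scope ring_scope.

(* The canonical norm `|v| on matrices is the sup norm, hence this one. *)
Definition norm2 (R : realType) (n : nat) (v : 'cV[R]_n) : R :=
  Num.sqrt (\sum_k v k 0 ^+ 2).

Definition locally_lipschitz (R : realType) (V W : normedModType R)
    (f : V -> W) : Prop :=
  forall x : V, exists2 U, nbhs x U & [lipschitz f y | y in U].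

(* In finite dimension, continuity of x |-> 'd f x for the operator norm is the
   same as continuity of x |-> 'd f x v for every direction v. *)
Definition continuously_differentiable (R : realType) (V : normedModType R)
    (f : V -> R) : Prop :=
  (forall x : V, differentiable f x) /\
  (forall v : V, continuous (fun x : V => 'd f x v : R)).

Definition is_max (R : realType) (A : set R) (a : R) : Prop := A a /\ ubound A a.
Definition is_min (R : realType) (A : set R) (a : R) : Prop := A a /\ lbound A a.

(* A joint state (or control, or noise value) of N agents is an n x N matrix
   whose i-th column belongs to agent i. The number of inputs of an agent is
   the dimension n of its state.
   "Closed loop": the joint control at time t is a function of the state
   history on [0, t]; static state feedback is the special case
   policy t x = k (x t). *)
Record system (R : realType) (N n : nat) := System {
  drift : 'I_N -> 'cV[R]_n -> 'cV[R]_n ;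
  gain : 'I_N -> 'cV[R]_n -> 'M[R]_n ;
  policy : R -> (R -> 'M[R]_(n, N)) -> 'M[R]_(n, N) ;
  noise_bound : R ;
  drift_lipschitz : forall i, locally_lipschitz (drift i) ;
  gain_lipschitz : forall i, locally_lipschitz (gain i) ;
  policy_causal : forall t (x y : R -> 'M[R]_(n, N)),
    (forall s, 0 <= s <= t -> x s = y s) -> policy t x = policy t y }.

Record safety_function (R : realType) (N n : nat) := SafetyFunction {
  hfun : 'I_N -> 'I_N -> 'M[R]_(n, N) -> R ;
  psi : R ;
  smoothing : R ;
  hfun_C1 : forall i j, i != j -> continuously_differentiable (hfun i j) ;
  psi_ge0 : 0 <= psi ;
  smoothing_gt0 : 0 < smoothing }.

Definition sensitivity (R : realType) (N n : nat) (eps : R) (i j : 'I_N)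
    (x : 'M[R]_(n, N)) : 'cV[R]_n :=
  let v := col i x - col j x in
  (expR (- norm2 v ^+ 2) / Num.sqrt (norm2 v ^+ 2 + eps ^+ 2)) *: v.

Definition htilde (R : realType) (N n : nat) (F : safety_function R N n)
    (i j : 'I_N) (x u : 'M[R]_(n, N)) : R :=
  hfun F i j x +
  psi F * ((sensitivity (smoothing F) i j x)^T *m (col i u - col j u)) 0 0.

Record rollout (R : realType) (Omega : Type) (N n : nat) := Rollout {
  state : Omega -> R -> 'M[R]_(n, N) ;
  control : Omega -> R -> 'M[R]_(n, N) ;
  noise : Omega -> R -> 'M[R]_(n, N) }.

Definition velocity (R : realType) (N n : nat) (S : system R N n)
    (x u w : 'M[R]_(n, N)) (i : 'I_N) : 'cV[R]_n :=
  drift S i (col i x) + gain S i (col i x) *m col i u + col i w.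

(* The noise is only bounded, so the differential equation is understood in
   Caratheodory's sense, i.e. in integrated form. *)
Definition is_solution (R : realType) (N n : nat) (S : system R N n) (T : R)
    (x u w : R -> 'M[R]_(n, N)) : Prop :=
  forall (i : 'I_N) (k : 'I_n),
    (@lebesgue_measure R).-integrable `[0, T]
      (EFin \o (fun s => velocity S (x s) (u s) (w s) i k 0)) /\
    forall t, 0 <= t <= T ->
      x t k i = x 0 k i +
        \int[@lebesgue_measure R]_(s in `[0, t])
          velocity S (x s) (u s) (w s) i k 0.

(* Generators of the sigma-algebra of events observable from a rollout. *)
Definition rollout_events (R : realType) (Omega : Type) (N n : nat) (T : R)
    (r : rollout R Omega N n) : set (set Omega) :=
  [set E | exists t (k : 'I_n) (i : 'I_N) (B : set R),
    [/\ 0 <= t <= T, measurable B &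
      [\/ E = [set o | B (state r o t k i)],
          E = [set o | B (control r o t k i)] |
          E = [set o | B (noise r o t k i)]]]].

Definition is_rollout (R : realType) (d : measure_display)
    (Omega : measurableType d) (N n : nat) (S : system R N n)
    (F : safety_function R N n) (T : R) (r : rollout R Omega N n) : Prop :=
  rollout_events T r `<=` measurable /\
  forall o : Omega,
    [/\ forall t i, 0 <= t <= T -> norm2 (col i (noise r o t)) <= noise_bound S,
        is_solution S T (state r o) (control r o) (noise r o),
        forall t, 0 <= t <= T -> control r o t = policy S t (state r o) &
        forall i j, i != j -> 0 <= htilde F i j (state r o 0) (control r o 0)].

Definition violation (R : realType) (Omega : Type) (N n : nat)
    (F : safety_function R N n) (T : R) (r : rollout R Omega N n) : set Omega :=
  [set o | exists t i j, [/\ 0 <= t <= T, i != j &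
    htilde F i j (state r o t) (control r o t) < 0]].

Definition is_observed_max (R : realType) (Omega : Type) (N n P : nat)
    (F : safety_function R N n) (T : R) (r : 'I_P -> rollout R Omega N n)
    (hmax : Omega -> 'I_N -> 'I_N -> R) : Prop :=
  forall o i j, i != j ->
    is_max [set a | exists p t, 0 <= t <= T /\
              a = htilde F i j (state (r p) o t) (control (r p) o t)]
           (hmax o i j).

Definition is_score (R : realType) (Omega : Type) (N n : nat)
    (F : safety_function R N n) (T eps : R)
    (hmax : Omega -> 'I_N -> 'I_N -> R) (r : rollout R Omega N n)
    (Z : Omega -> R) : Prop :=
  forall o,
    (violation F T r o -> Z o = 0) /\
    (~ violation F T r o ->
       is_min [set a | exists t i j, [/\ 0 <= t <= T, i != j &
                 a = htilde F i j (state r o t) (control r o t) /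
                     Num.max (hmax o i j) eps]]
              (Z o)).

Lemma score_itv01 (R : realType) (Omega : Type) (N n P : nat)
    (F : safety_function R N n) (T eps : R) (r : 'I_P -> rollout R Omega N n)
    (hmax : Omega -> 'I_N -> 'I_N -> R) (p : 'I_P) (Z : Omega -> R) :
  0 < eps -> is_observed_max F T r hmax -> is_score F T eps hmax (r p) Z ->
  forall o, 0 <= Z o <= 1.
Proof.
move=> eps0 hm hZ o; have [Z0 Zmin] := hZ o.
have [/Z0 ->|nv] := pselect (violation F T (r p) o); first by rewrite lexx ler01.
have [[t [i [j [tT ij ->]]]] _] := Zmin nv.
have M0 : 0 < Num.max (hmax o i j) eps by rewrite lt_max eps0 orbT.
have [_ ub] := hm o i j ij.
apply/andP; split; last first.
  by rewrite ler_pdivrMr// mul1r le_max ub//; exists p, t.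
rewrite divr_ge0 ?(ltW M0)// leNgt; apply/negP => h0.
by apply: nv; exists t, i, j.
Qed.

(* Mutual independence: the product rule for every finite subfamily. *)
Definition mutually_independent (R : realType) (d : measure_display)
    (Omega : measurableType d) (Pr : probability Omega R) (I : finType)
    (G : I -> set (set Omega)) : Prop :=
  forall (J : {set I}) (E : I -> set Omega), (forall i, G i (E i)) ->
    fine (Pr (\bigcap_(i in [set` J]) E i)) = \prod_(i in J) fine (Pr (E i)).

Definition iid_bernoulli (R : realType) (d : measure_display)
    (Omega : measurableType d) (Pr : probability Omega R) (I : finType)
    (X : I -> Omega -> bool) (q : R) : Prop :=
  (forall i (B : set bool), Pr (X i @^-1` B) = bernoulli_prob q B) /\
  mutually_independent Pr (fun i => [set X i @^-1` B | B in setT]).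

Definition empirical_mean (R : realType) (P : nat) (x : 'I_P -> R) : R :=
  P%:R^-1 * \sum_(i < P) x i.

Definition empirical_variance (R : realType) (P : nat) (x : 'I_P -> R) : R :=
  (P%:R * (P%:R - 1))^-1 *
  \sum_(i < P) \sum_(j < P | (i < j)%N) (x i - x j) ^+ 2.

(* Main.v *)
(* The number K of violations among n = P rollouts is binomial, and on K = k the
   sample variance is n/(n - 1) * p (1 - p) with p = k/n, so the bound depends
   on k only. Let k be the largest count at which the bound falls below q. The
   bad event is contained in {K <= k}, so no union bound over an
   empirical-variance event is needed: Chernoff's inequality, obtained by
   changing the parameter q to p, gives Pr(K <= k) <= exp(- n KL(p, q)). With
   t = q - p one has KL(p, q) >= t^2 / (2 (p (1 - p) + t)), and a violated bound
   at k makes this at least ln(2/delta) / n. *)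
Require Import Defs.
From HB Require Import structures.
From mathcomp Require Import all_boot all_order all_algebra.
From mathcomp Require Import all_classical all_reals all_analysis.
From mathcomp Require Import ring lra.
Set Implicit Arguments.
Unset Strict Implicit.
Unset Printing Implicit Defensive.
Import Order.TTheory GRing.Theory Num.Theory.
Import numFieldNormedType.Exports.
Local Open Scope classical_set_scope.
Local Open Scope ring_scope.

(** * Second-order exponential bounds for 1 + u and 1 - v *)

Lemma le1Dx_expR (R : realType) (u : R) : 0 <= u ->
  1 + u <= expR (u - u ^+ 2 / (2 * (1 + u))).
Proof.
(* With x = 1 + u the exponent is (x - 1/x) / 2, so the claim reads 2 ln x <= x - 1/x for x >= 1.
   The difference [f] vanishes at 1 and its derivative is the square (1 - 1/x)^2. *)
move=> u0; set f := fun x : R => (x - x^-1) - 2 * ln x.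
pose df (x : R) : R := (1 - x^-1) ^+ 2.
have Df (x : R) : 0 < x -> is_derive x 1 f (df x).
  move=> x0; have x1 : x != 0 by rewrite gt_eqF.
  have dl := is_derive1_ln x0.
  have dV : is_derive x 1 (fun y : R => y^-1) (- x ^- 2).
    have := @is_deriveV R id x 1 1 x1 (is_derive_id x 1).
    by rewrite /= -[_ *: _]/(_ * _) mulr1.
  have := is_deriveB (is_deriveB (is_derive_id x 1) dV) (is_deriveZ 2 dl).
  move=> H; apply: (is_derive_eq H).
  by rewrite /df -[_ *: _]/(_ * _); field.
have cf : {within `[1, 1 + u], continuous f}.
  apply: continuous_in_subspaceT => x; rewrite inE/= in_itv/= => /andP[x1 _].
  apply/differentiable_continuous/derivable1_diffP.
  by have [] := Df x (lt_le_trans ltr01 x1).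
have [|x|c _ fE] := @MVT_segment R f df 1 (1 + u) _ _ cf; first by lra.
  by rewrite in_itv/= => /andP[x1 _]; apply: Df; lra.
have f1 : f 1 = 0 by rewrite /f ln1 invr1; lra.
have fu : 0 <= f (1 + u).
  have -> : f (1 + u) = df c * (1 + u - 1) by rewrite -fE f1 subr0.
  by rewrite mulr_ge0 ?sqr_ge0//; lra.
have u1 : 1 + u \is Num.pos by rewrite posrE; lra.
rewrite -[leLHS](lnK u1) ler_expR.
have -> : u - u ^+ 2 / (2 * (1 + u)) = ((1 + u) - (1 + u)^-1) / 2.
  by field; rewrite gt_eqF// -posrE.
by rewrite /f in fu; lra.
Qed.

(** The product (1 - x) exp(x + x^2/2) equals 1 at 0 and has derivative - x^2 exp(x + x^2/2), so it
    stays below 1 for x >= 0. Avoiding the logarithm lets the argument cover v >= 1 too. *)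
Lemma le1Bx_expR (R : realType) (v : R) : 0 <= v ->
  1 - v <= expR (- (v + v ^+ 2 / 2)).
Proof.
move=> v0; set f := fun x : R => (1 - x) * expR (x + 2^-1 * x ^+ 2).
pose df (x : R) : R := - (x ^+ 2 * expR (x + 2^-1 * x ^+ 2)).
have Df (x : R) : is_derive x 1 f (df x).
  have d1 := is_deriveB (is_derive_cst (1 : R) x 1) (is_derive_id x 1).
  have d2 := is_deriveD (is_derive_id x 1)
    (is_deriveZ 2^-1 (is_deriveX 2 (is_derive_id x 1))).
  have d3 := is_derive1_comp (is_derive_expR _) d2.
  have := is_deriveM d1 d3.
  move=> H; apply: (is_derive_eq H).
  rewrite /df/= /GRing.scale/= -[(id + _) x]/(x + 2^-1 * x ^+ 2).
  rewrite -[(_ - id) x]/(1 - x).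
  by field.
have cf : {within `[0, v], continuous f}.
  apply: continuous_subspaceT => x.
  by apply/differentiable_continuous/derivable1_diffP; have [] := Df x.
have [c _ fE] := MVT_segment v0 (fun x _ => Df x) cf.
have f0 : f 0 = 1 by rewrite /f subr0 mul1r add0r expr0n/= mulr0 expR0.
have fv : f v <= 1.
  rewrite -f0 -subr_le0 fE subr0 mulNr. rewrite oppr_le0.
  by apply: mulr_ge0 => //; apply: mulr_ge0; [exact: sqr_ge0|exact: expR_ge0].
by rewrite expRN -[leRHS]mul1r ler_pdivlMr ?expR_gt0// [v ^+ 2 / 2]mulrC.
Qed.

(** * Bernoulli product weights and Chernoff's lower tail *)

Lemma prod_bernoulli_pmf (R : realType) (I : finType) (q : R)
    (b : {ffun I -> bool}) :
  \prod_i bernoulli_pmf q (b i) =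
  q ^+ (\sum_i b i)%N * (1 - q) ^+ (#|I| - \sum_i b i)%N.
Proof.
have -> : (\sum_i b i)%N = #|[pred i | b i]| by rewrite -big_mkcond sum1_card.
rewrite -[X in (X - _)%N](cardC [pred i | b i]) addKn.
rewrite (bigID b)/=; congr (_ * _); under eq_bigr do rewrite /bernoulli_pmf.
  by rewrite -prodr_const; apply: eq_bigr => i ->.
by rewrite -prodr_const; apply: eq_bigr => i /negPf ->.
Qed.

Lemma sum_prod_bernoulli_pmf (R : realType) (I : finType) (q : R) :
  \sum_(b : {ffun I -> bool}) \prod_i bernoulli_pmf q (b i) = 1.
Proof.
rewrite -(bigA_distr_bigA (fun _ => bernoulli_pmf q)) big1// => i _.
by rewrite big_bool/= addrCA subrr addr0.
Qed.

(* The left-hand side is exp(- n KL(p, q)). *)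
Lemma tilt_le_expR (R : realType) (n k : nat) (p q : R) :
  (0 < n)%N -> (k <= n)%N -> p = k%:R / n%:R -> 0 < p -> p < q -> q <= 1 ->
  (q / p) ^+ k * ((1 - q) / (1 - p)) ^+ (n - k) <=
  expR (- (n%:R * ((q - p) ^+ 2 / (2 * (p * (1 - p) + (q - p)))))).
Proof.
move=> n0 kn pE p0 pq q1; set t := q - p.
have t0 : 0 < t by rewrite subr_gt0.
have p1 : 0 < 1 - p by lra.
have n0R : 0 < n%:R :> R by rewrite ltr0n.
have kE : k%:R = n%:R * p by rewrite pE mulrC divfK ?gt_eqF.
have nkE : (n - k)%:R = n%:R * (1 - p) by rewrite natrB// kE; ring.
have hq : q / p <= expR (t / p - (t / p) ^+ 2 / (2 * (1 + t / p))).
  have -> : q / p = 1 + t / p by rewrite /t; field; rewrite gt_eqF.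
  by apply: le1Dx_expR; rewrite divr_ge0// ltW.
have hq' : (1 - q) / (1 - p) <= expR (- (t / (1 - p) + (t / (1 - p)) ^+ 2 / 2)).
  have -> : (1 - q) / (1 - p) = 1 - t / (1 - p).
    by rewrite /t; field; rewrite gt_eqF.
  by apply: le1Bx_expR; rewrite divr_ge0// ltW.
apply: (@le_trans _ _ (expR (t / p - (t / p) ^+ 2 / (2 * (1 + t / p))) ^+ k *
   expR (- (t / (1 - p) + (t / (1 - p)) ^+ 2 / 2)) ^+ (n - k))).
  by apply: ler_pM; rewrite ?exprn_ge0 ?lerXn2r ?nnegrE ?expR_ge0// divr_ge0//; lra.
rewrite -!expRM_natl -expRD ler_expR kE nkE.
have D0 : 0 < p * (1 - p) + t by rewrite addr_gt0 ?mulr_gt0.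
have pt0 : 0 < p + t by rewrite addr_gt0.
(* The first-order terms n t and - n t cancel; the second-order ones combine through 1/(p + t) +
   1/(1 - p) = (1 + t) / ((p + t)(1 - p)). *)
have -> : n%:R * p * (t / p - (t / p) ^+ 2 / (2 * (1 + t / p))) +
    n%:R * (1 - p) * - (t / (1 - p) + (t / (1 - p)) ^+ 2 / 2) =
    - (n%:R * (t ^+ 2 / 2 * ((1 + t) / ((p + t) * (1 - p))))).
  by field; rewrite !gt_eqF.
have -> : t ^+ 2 / (2 * (p * (1 - p) + t)) = t ^+ 2 / 2 * (1 / (p * (1 - p) + t)).
  by field; rewrite gt_eqF.
rewrite lerN2 ler_pM2l// ler_pM2l ?divr_gt0 ?exprn_gt0//.
(* What remains is (p + t)(1 - p) <= (1 + t)(p (1 - p) + t); the right side exceeds the left by t (p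
   (1 - p) + t) + t p. *)
rewrite ler_pdivrMr// mulrAC ler_pdivlMr ?mulr_gt0// mul1r.
have := mulr_gt0 t0 D0; have := mulr_gt0 t0 p0; lra.
Qed.

(** Change of parameter: a vector with j ones weighs (q/p)^j ((1 - q)/(1 - p))^(n - j) times more
    under q than under p. As p < q this factor grows with j, so on j <= k it is at most its value at
    k, and the weights under p sum to at most 1. *)
Lemma bernoulli_lower_tail (R : realType) (I : finType) (k : nat) (q : R) :
  let n := #|I| in let p := k%:R / n%:R in
  (0 < n)%N -> p < q -> q <= 1 ->
  \sum_(b : {ffun I -> bool} | (\sum_i b i <= k)%N)
    \prod_i bernoulli_pmf q (b i) <=
  expR (- (n%:R * ((q - p) ^+ 2 / (2 * (p * (1 - p) + (q - p)))))).
Proof.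
move=> n p n0 pq q1; set rho := expR _.
have n0R : 0 < n%:R :> R by rewrite ltr0n.
have p0 : 0 <= p by rewrite divr_ge0// ler0n.
have q0 : 0 < q by apply: le_lt_trans pq.
have kn : (k < n)%N.
  by have := lt_le_trans pq q1; rewrite ltr_pdivrMr// mul1r ltr_nat.
have p01 : 0 <= p <= 1 by rewrite p0 ltW// (lt_le_trans pq).
have p1 : 0 < 1 - p by rewrite subr_gt0 (lt_le_trans pq).
have q1' : 0 <= 1 - q by rewrite subr_ge0.
suff H (b : {ffun I -> bool}) : (\sum_i b i <= k)%N ->
    \prod_i bernoulli_pmf q (b i) <= rho * \prod_i bernoulli_pmf p (b i).
  apply: (@le_trans _ _ (\sum_(b : {ffun I -> bool} | (\sum_i b i <= k)%N)
      rho * \prod_i bernoulli_pmf p (b i))); first exact: ler_sum.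
  rewrite -mulr_sumr ler_piMr ?expR_ge0// -[leRHS](sum_prod_bernoulli_pmf I p).
  rewrite [leRHS](bigID (fun b : {ffun I -> bool} => (\sum_i b i <= k)%N))/=.
  by rewrite lerDl sumr_ge0// => b _; apply: prodr_ge0 => i _; apply: bernoulli_pmf_ge0.
rewrite !prod_bernoulli_pmf -/n; move: (\sum_i b i)%N => j jk.
have jn : (j <= n)%N by apply: leq_trans jk (ltnW kn).
(* Here p = 0 and the ratio q / p is meaningless. Only the all-false vector remains, and (1 - q)^n
   <= exp(- n (q + q^2/2)) is compared directly with the target exp(- n q / 2). *)
have [k0|k0] := posnP k.
  move: jk; rewrite /rho /p k0 leqn0 => /eqP->.
  rewrite !mul0r !subr0 subn0 !expr0 !mul1r add0r expr1n mulr1.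
  apply: (@le_trans _ _ (expR (- (q + q ^+ 2 / 2)) ^+ n)).
    by apply: lerXn2r; rewrite ?nnegrE ?expR_ge0//; apply/le1Bx_expR/ltW.
  rewrite -expRM_natl ler_expR mulrN lerN2 ler_pM2l//.
  have -> : q ^+ 2 / (2 * q) = q / 2 by field; rewrite gt_eqF.
  by have := sqr_ge0 q; lra.
have p0' : 0 < p by rewrite divr_gt0// ltr0n.
have tilt : (q / p) ^+ j * ((1 - q) / (1 - p)) ^+ (n - j) <= rho.
  apply: le_trans (tilt_le_expR n0 (ltnW kn) erefl p0' pq q1).
  have [a0 b0] : 0 <= q / p /\ 0 <= (1 - q) / (1 - p).
    by split; rewrite divr_ge0// ltW.
  apply: ler_pM; rewrite ?exprn_ge0//.
    by rewrite ler_weXn2l// ler_pdivlMr// mul1r ltW.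
  by rewrite ler_wiXn2l// ?leq_sub2l// ler_pdivrMr// mul1r lerB// ltW.
apply: le_trans (ler_wpM2r _ tilt); last first.
  by rewrite mulr_ge0// exprn_ge0// ltW.
by rewrite mulrACA -!exprMn !divfK ?gt_eqF.
Qed.

(** * Algebra of the deviation and of the sample variance *)

Lemma sqrt_deviation (R : realType) (s l t : R) : 0 <= s -> 0 <= l ->
  Num.sqrt (2 * s * l) + 7 * l / 3 < t -> l <= t ^+ 2 / (2 * (s + t)).
Proof.
move=> s0 l0; set a := Num.sqrt _ => at_.
have a0 : 0 <= a by apply: sqrtr_ge0.
have aE : a ^+ 2 = 2 * s * l by rewrite sqr_sqrtr// !mulr_ge0.
have t0 : 0 < t by lra.
rewrite ler_pdivlMr; last lra.
(* From t > a + 7l/3 and t >= a: t^2 >= a t + 7lt/3 >= a^2 + 7lt/3 = 2sl + 7lt/3, and 7/3 >= 2 gives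
   t^2 >= 2l (s + t). *)
have h1 : a * t >= a ^+ 2 by rewrite expr2 ler_wpM2l//; lra.
have h2 : (t - 7 * l / 3) * t >= a * t by rewrite ler_pM2r//; lra.
have h3 : 0 <= l * t by rewrite mulr_ge0// ltW.
nra.
Qed.

(** A pair contributes 1 exactly when its bits differ, and k (n - k) pairs do. The computation
    doubles the sum to all ordered pairs and expands the squares using x^2 = x. *)
Lemma sum_pairs_sqr_bool (R : realType) (n : nat) (b : 'I_n -> bool) :
  let k := (\sum_i b i)%N in
  \sum_(i < n) \sum_(j < n | (i < j)%N) ((b i)%:R - (b j)%:R) ^+ 2 =
  k%:R * (n%:R - k%:R) :> R.
Proof.
move=> k; set x := fun i : 'I_n => (b i)%:R : R.
have kE : \sum_i x i = k%:R by rewrite /k natr_sum.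
pose D := \sum_(i < n) \sum_(j < n | (i < j)%N) (x i - x j) ^+ 2.
suff : D + D = 2 * (k%:R * (n%:R - k%:R)) by rewrite -/D; lra.
have -> : D + D = \sum_(i < n) \sum_(j < n) (x i - x j) ^+ 2.
  have D' : D = \sum_(i < n) \sum_(j < n | (j < i)%N) (x i - x j) ^+ 2.
    rewrite /D (exchange_big_dep predT)//=; apply: eq_bigr => i _.
    by apply: eq_bigr => j _; rewrite -sqrrN opprB.
  rewrite {2}D' -big_split/=; apply: eq_bigr => i _.
  rewrite [RHS](bigID (fun j : 'I_n => (i < j)%N))/=; congr (_ + _).
  rewrite [RHS](bigD1 i) ?ltnn//= subrr expr0n/= add0r.
  by apply: eq_bigl => j; rewrite -leqNgt [RHS]andbC ltn_neqAle.
have xx i : x i ^+ 2 = x i by rewrite /x; case: (b i); rewrite ?expr1n ?expr0n.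
transitivity (\sum_(i < n) (n%:R * x i + k%:R - 2 * x i * k%:R)).
  apply: eq_bigr => i _.
  under eq_bigr do rewrite sqrrB !xx -mulr_natl mulrA addrAC.
  rewrite sumrB big_split/= sumr_const card_ord kE -mulr_sumr kE.
  by rewrite [n%:R * _]mulr_natl.
rewrite sumrB big_split/= -mulr_sumr kE sumr_const card_ord.
rewrite -mulr_suml -mulr_sumr kE -[k%:R *+ n]mulr_natl; ring.
Qed.

(** * Transfer of events on the sample space to sums over bit vectors *)

Lemma iid_bernoulli_joint_law (R : realType) (d : measure_display)
    (Omega : measurableType d) (Pr : probability Omega R) (I : finType)
    (X : I -> Omega -> bool) (q : R) (G : pred {ffun I -> bool}) :
  (forall i, measurable (X i @^-1` [set true])) -> 0 <= q <= 1 ->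
  iid_bernoulli Pr X q ->
  Pr [set o | G [ffun i => X i o]] =
  (\sum_(b : {ffun I -> bool} | G b) \prod_i bernoulli_pmf q (b i))%:E.
Proof.
move=> mX q01 [law indep].
have mXb i c : measurable (X i @^-1` [set c]).
  case: c => //; rewrite (_ : _ @^-1` _ = ~` (X i @^-1` [set true])).
    exact: measurableC.
  by apply/seteqP; split => o /=; case: (X i o).
(* The event is the finite disjoint union of these atoms; independence for the full index set turns
   the mass of each into a product. *)
pose atom (b : {ffun I -> bool}) := \bigcap_(i in [set` [set: I]%SET]) (X i @^-1` [set b i]).
have atomP b o : atom b o <-> [ffun i => X i o] = b.
  split=> [ob|<- i _ /=]; last by rewrite ffunE.
  by apply/ffunP => i; rewrite ffunE; apply: ob; rewrite /= finset.in_setT.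
have matom b : measurable (atom b).
  by apply: fin_bigcap_measurable => // i _; exact: mXb.
have Patom b : Pr (atom b) = (\prod_i bernoulli_pmf q (b i))%:E.
  rewrite -[LHS]fineK ?fin_num_measure// (indep _ (fun i => X i @^-1` [set b i])).
    congr EFin; apply: eq_big => [i|i _]; first by rewrite finset.in_setT.
    rewrite law bernoulli_probE//.
    have memE (c c' : bool) : (c \in [set c']%classic) = (c == c').
      by apply/idP/eqP => [/set_mem|->] //; rewrite mem_set.
    by case: (b i); rewrite !diracE !memE/= mulr0 mulr1 ?addr0 ?add0r.
  by move=> i; exists [set b i].
have -> : [set o | G [ffun i => X i o]] =
    \bigcup_(b in [set` enum G]) atom b.
  apply/seteqP; split=> [w Gw|w [b /= Gb /atomP wb]].
    by exists [ffun i => X i w]; [rewrite /= mem_enum | apply/atomP].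
  by rewrite wb -[G b]/(b \in G) -mem_enum.
rewrite measure_fin_bigcup//; last first.
  apply/trivIsetP => b c _ _ /eqP bc; apply/seteqP.
  by split=> [w [/atomP wb /atomP wc]|//]; apply: bc; rewrite -wb.
rewrite -sumEFin -fsbig_seq ?enum_uniq// big_enum/=.
exact: eq_bigr.
Qed.

(** * The empirical Bernstein bound on bit vectors, then on rollouts *)

Definition empirical_bernstein_bound (R : realType) (n : nat) (delta : R)
    (b : 'I_n -> bool) : R :=
  let x i : R := (b i)%:R in
  empirical_mean x
  + Num.sqrt (2 * empirical_variance x * ln (2 / delta) / n%:R)
  + 7 * ln (2 / delta) / (3 * (n%:R - 1)).

Lemma empirical_bernstein_bernoulli (R : realType) (n : nat) (q delta : R) :
  (2 <= n)%N -> 0 <= q <= 1 -> 0 < delta < 1 ->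
  \sum_(b : {ffun 'I_n -> bool} | ~~ (q <= empirical_bernstein_bound delta b))
    \prod_i bernoulli_pmf q (b i) <= delta.
Proof.
move=> n2 /andP[q0 q1] /andP[d0 d1].
pose bound (b : {ffun 'I_n -> bool}) := empirical_bernstein_bound delta b.
rewrite -/bound; set L := ln (2 / delta).
pose S (b : {ffun 'I_n -> bool}) := (\sum_i b i)%N.
have n1 : 1 < n%:R :> R by rewrite ltr1n.
have L0 : 0 <= L by rewrite ln_ge0// ler_pdivlMr//; lra.
(* The factor n/(n - 1) in the sample variance turns L/n under the root into L/(n - 1), so both
   correction terms are expressed in the same [l]. *)
pose l := L / (n%:R - 1).
have l0 : 0 <= l by rewrite divr_ge0//; lra.
have boundE b : let p := (S b)%:R / n%:R in
    bound b = p + Num.sqrt (2 * (p * (1 - p)) * l) + 7 * l / 3.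
  rewrite /bound /empirical_bernstein_bound /empirical_mean /empirical_variance -natr_sum.
  rewrite sum_pairs_sqr_bool -/(S b) -/L mulrC /l; congr (_ + Num.sqrt _ + _).
    by field; rewrite !gt_eqF//; lra.
  by field; rewrite gt_eqF; lra.
have p01 b : 0 <= (S b)%:R / n%:R <= (1 : R).
  rewrite divr_ge0//= ler_pdivrMr ?mul1r ?ler_nat; last lra.
  apply: (@leq_trans (\sum_(i < n) 1)); first by apply: leq_sum => i _; case: (b i).
  by rewrite sum1_card card_ord.
have [b0 bad0|none] := pickP (fun b => ~~ (q <= bound b)); last first.
  by rewrite big_pred0 ?ltW.
(* Among the vectors violating the bound, [c] has the most ones; every violating vector then lies in
   the lower tail at [S c]. *)
case: (@arg_maxnP _ b0 (fun b => ~~ (q <= bound b)) S bad0) => c cbad cmax.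
set p := (S c)%:R / n%:R : R; set t := q - p.
have /andP[p0 p1] : 0 <= p <= 1 by exact: p01.
have s0 : 0 <= p * (1 - p) by rewrite mulr_ge0// subr_ge0.
have tdev : Num.sqrt (2 * (p * (1 - p)) * l) + 7 * l / 3 < t.
  by move: cbad; rewrite -ltNge boundE -/p /t; lra.
have t0 : 0 < t.
  by apply: le_lt_trans tdev; rewrite addr_ge0 ?sqrtr_ge0//; lra.
have pmf0 (b : {ffun 'I_n -> bool}) : 0 <= \prod_i bernoulli_pmf q (b i).
  by apply: prodr_ge0 => i _; rewrite bernoulli_pmf_ge0// q0.
apply: (@le_trans _ _ (\sum_(b : {ffun 'I_n -> bool} | (S b <= S c)%N)
    \prod_i bernoulli_pmf q (b i))).
  rewrite [leRHS](bigID (fun b => ~~ (q <= bound b)))/=.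
  rewrite (eq_bigl (fun b => (S b <= S c)%N && ~~ (q <= bound b))) ?lerDl ?sumr_ge0//.
  by move=> b; rewrite andbC; case: (boolP (q <= bound b)) => //= bb; exact/esym/(cmax b bb).
have pq : (S c)%:R / #|'I_n|%:R < q by rewrite card_ord -subr_gt0.
apply: le_trans (bernoulli_lower_tail _ pq q1) _; first by rewrite card_ord ltnW.
rewrite card_ord -/p -/t.
(* The deviation inequality controls [l]; multiplying by n suffices because n l = L n/(n - 1) >=
   L. *)
have Lle : L <= n%:R * (t ^+ 2 / (2 * (p * (1 - p) + t))).
  have := sqrt_deviation s0 l0 tdev => /(ler_wpM2l (ler0n R n)); apply: le_trans.
  rewrite /l mulrA ler_pdivlMr ?subr_gt0// [leLHS]mulrC ler_wpM2r//; lra.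
(* In fact exp(- L) = delta / 2. *)
have: expR (- L) <= delta.
  rewrite /L -lnV ?posrE ?divr_gt0// lnK ?posrE ?invr_gt0 ?divr_gt0//.
  by rewrite invf_div; lra.
by apply: le_trans; rewrite ler_expR lerN2.
Qed.

Theorem mainTheorem2 (R : realType) (d : measure_display)
    (Omega : measurableType d) (Pr : probability Omega R)
    (N n : nat) (S : system R N n) (F : safety_function R N n)
    (T eps : R) (P : nat) (theta delta : R)
    (r : 'I_P -> rollout R Omega N n) (hmax : Omega -> 'I_N -> 'I_N -> R)
    (Zs : 'I_P -> {RV Pr >-> R}) (Z : {RV Pr >-> R})
    (T_ge0 : 0 <= T) (eps_gt0 : 0 < eps) (P_ge2 : (2 <= P)%N)
    (theta01 : 0 < theta < 1) (delta01 : 0 < delta < 1)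
    (r_rollout : forall p, is_rollout S F T (r p))
    (r_indep : mutually_independent Pr (fun p => <<s rollout_events T (r p) >>))
    (hmaxP : is_observed_max F T r hmax)
    (ZsP : forall p, is_score F T eps hmax (r p) (Zs p))
    (Z_law : forall p (B : set R), measurable B ->
       Pr (Zs p @^-1` B) = Pr (Z @^-1` B)) :
  let q : R := fine (Pr [set o | Z o < theta]) in
  let X (p : 'I_P) (o : Omega) : bool := Zs p o < theta in
  iid_bernoulli Pr X q ->
  let bound (o : Omega) : R :=
    let x (p : 'I_P) : R := (X p o)%:R in
    empirical_mean x
    + Num.sqrt (2 * empirical_variance x * ln (2 / delta) / P%:R)
    + 7 * ln (2 / delta) / (3 * (P%:R - 1)) in
  ((1 - delta)%:E <= Pr [set o | (q <= bound o)%R])%E.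
Proof.
move=> q X Xiid.
pose B (b : 'I_P -> bool) := empirical_bernstein_bound delta b.
change ((1 - delta)%:E <= Pr [set o | (q <= B (X^~ o))%R])%E.
have mlt (Y : {RV Pr >-> R}) : measurable [set o | Y o < theta].
  rewrite (_ : [set o | Y o < theta] = Y @^-1` `]-oo, theta[).
    by rewrite -[_ @^-1` _]setTI; exact: measurable_funP.
  by apply/seteqP; split => o /=; rewrite in_itv.
have q01 : 0 <= q <= 1.
  rewrite fine_ge0//= -lee_fin fineK ?fin_num_measure//.
  exact: probability_le1.
have -> : [set o | q <= B (X^~ o)] = [set o | q <= B [ffun i => X i o]].
  apply/funext => o /=; congr (is_true (q <= B _)).
  by apply/funext => i; rewrite ffunE.
rewrite (@iid_bernoulli_joint_law _ _ _ _ _ X q (fun b : {ffun 'I_P -> bool} => q <= B b))// => [|i]; last first.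
  by rewrite (_ : _ @^-1` _ = [set o | Zs i o < theta]).
(* Writing 1 as the total weight and cancelling the vectors that satisfy the bound leaves the weight
   of the violating ones, to be at most [delta]. *)
rewrite lee_fin lerBlDr -[leLHS](sum_prod_bernoulli_pmf 'I_P q).
rewrite [leLHS](bigID (fun b : {ffun 'I_P -> bool} => q <= B b))/= lerD2l.
exact: empirical_bernstein_bernoulli.
Qed.
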